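(* Let $d,m\ge 2$ be integers, let $H$ be a prime field, and let $\mathbb{F}$ be an extension of $H$ of degree $[\mathbb{F}:H]=m$ with $|\mathbb{F}|\ge 2md$. Let $\delta=1-d/|\mathbb{F}|$ and let $\tau\le\delta/2$ and $\rho\le\delta/8$. Consider the $m$-step $H$-plane-line random walk (described in the context) run on input $f\colon\mathbb{F}^m\to\mathbb{F}$ and $x\in\mathbb{F}^m$. Then: (1) (perfect completeness) if $f\in\mathrm{RM}_{\mathbb{F}}(m,d)$, then for every $x$ and every outcome of the walk, each restriction $f|_{P_i}$, $0\le i\le m$, lies in $\mathrm{RM}_{\mathbb{F}}(2,d)$; (2) (robust soundness) if $\mathrm{dist}(f,Q^* )\le\tau$ for some $Q^*\in\mathrm{RM}_{\mathbb{F}}(m,d)$ but $f(x)\ne Q^*(x)$, then \[ \Pr\Big[\mathrm{dist}_{\{(0,0)\}}\big(f|_{P_0},\mathrm{RM}_{\mathbb{F}}(2,d)\big)\ge\rho\ \ \vee\ \ \exists i\in[m]:\ \mathrm{dist}_{L}\big(f|_{P_i},\mathrm{RM}_{\mathbb{F}}(2,d)\big)\ge\rho\Big]\ \ge\ \Big(1-\frac{4}{|\mathbb{F}|}\Big)^m-\frac{\tau+\frac{2}{|H|}}{\delta-2\rho}, \] where $L=\{(t,0):t\in\mathbb{F}\}\subseteq\mathbb{F}^2$.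
   Context: $\mathrm{RM}_{\mathbb{F}}(m,d)$ is the set of evaluation tables $\mathbb{F}^m\to\mathbb{F}$ of polynomials in $m$ variables of total degree at most $d$ over $\mathbb{F}$. $\mathrm{dist}$ is relative Hamming distance. Weighted distance: for $N$-length strings $u,v$ indexed by a set $I$ with $|I|=N$ and $\emptyset\ne A\subseteq I$, $\mathrm{dist}_A(u,v)=\frac{|\{i\in A:u_i\ne v_i\}|}{2|A|}+\frac{|\{i\in I:u_i\ne v_i\}|}{2N}$, and $\mathrm{dist}_A(u,S)=\min_{v\in S}\mathrm{dist}_A(u,v)$. For $a\in\mathbb{F}^m$ and $h,h'\in\mathbb{F}^m$, the plane $P=(a,h,h')$ is $\{a+th+sh':t,s\in\mathbb{F}\}$ and $f|_P\colon\mathbb{F}^2\to\mathbb{F}$ is $(t,s)\mapsto f(a+th+sh')$ (so $(0,0)$ corresponds to $a$ and $L=\{(t,0)\}$ corresponds to the line $\{a+th:t\in\mathbb{F}\}$). The $m$-step $H$-plane-line random walk from $x$: set $x_0=x$, choose $h_0,h_0'\in H^m$ uniformly, and let $P_0=(x_0,h_0,h_0')$. For $i=1,\dots,m$: choose $s_{i-1},s'_{i-1},t_{i-1},t'_{i-1}\in\mathbb{F}$ uniformly, set $x_i=x_{i-1}+s_{i-1}h_{i-1}+s'_{i-1}h'_{i-1}$, $h_i=t_{i-1}h_{i-1}+t'_{i-1}h'_{i-1}$, the line $\ell_i=\{x_i+th_i:t\in\mathbb{F}\}$, choose $h'_i\in H^m$ uniformly, and set $P_i=(x_i,h_i,h'_i)$.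 All random choices are independent. *)

(* Defs.v *)
From HB Require Import structures.
From mathcomp Require Import all_boot all_order all_algebra.
From mathcomp Require Import mpoly.
From Stdlib Require Import ClassicalDescription.
Set Implicit Arguments. Unset Strict Implicit. Unset Printing Implicit Defensive.
Import Order.TTheory GRing.Theory Num.Theory.
Local Open Scope ring_scope.

Definition decP (P : Prop) : bool :=
  if excluded_middle_informative P then true else false.

Section RMDefs.
Variable F : finFieldType.

Definition table k := {ffun 'rV[F]_k -> F}.

(* RM_F(k,d): evaluation tables of polynomials in k variables of total degree <= d
   (msize P = 1 + total degree of P, and 0 for P = 0). *)
Definition is_RM (k d : nat) (g : table k) : Prop :=
  exists P : {mpoly F[k]}, (msize P <= d.+1)%N /\
    forall x : 'rV[F]_k, g x = P.@[fun i => x ord0 i].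

Definition RM (k d : nat) : {set table k} := [set g | decP (is_RM d g)].

Variable R : realFieldType.

Definition hdist k (u v : table k) : R :=
  #|[set x | u x != v x]|%:R / #|'rV[F]_k|%:R.

Definition distA k (A : {set 'rV[F]_k}) (u v : table k) : R :=
  #|[set x in A | u x != v x]|%:R / (2 * #|A|%:R)
  + #|[set x | u x != v x]|%:R / (2 * #|'rV[F]_k|%:R).

(* dist_A(u, RM_F(k,d)) = min over the (nonempty, it contains 0) code;
   the fold is seeded with dist_A(u, 0), 0 being a codeword. *)
Definition distRM k d (A : {set 'rV[F]_k}) (u : table k) : R :=
  \big[Num.min/distA A u 0]_(v in RM k d) distA A u v.

Definition restr m (f : table m) (a h h' : 'rV[F]_m) : table 2 :=
  finfun (fun v : 'rV[F]_2 => f (a + v ord0 ord0 *: h + v ord0 (lift ord0 ord0) *: h')).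

Definition origin2 : {set 'rV[F]_2} := [set 0].
Definition L2 : {set 'rV[F]_2} := [set v : 'rV[F]_2 | v ord0 (lift ord0 ord0) == 0].

(* the prime subfield H of F (F of characteristic p) *)
Definition Hset (p : nat) : {set F} := [set x | [exists k : 'I_p, x == k%:R]].
Definition inHm (p m : nat) (h : 'rV[F]_m) : bool := [forall i, h ord0 i \in Hset p].

(* An outcome of the m-step walk: (h_0, h_0', step) where step j (j < m) is
   (s_j, s'_j, t_j, t'_j, h'_{j+1}). *)
Definition outcome m := ('rV[F]_m * 'rV[F]_m * {ffun 'I_m -> F * F * F * F * 'rV[F]_m})%type.

Definition valid p m (w : outcome m) : bool :=
  [&& inHm p w.1.1, inHm p w.1.2 & [forall j, inHm p (w.2 j).2]].

Definition stepn m (w : outcome m) (i : nat) : F * F * F * F * 'rV[F]_m :=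
  if insub i is Some j then w.2 j else (0, 0, 0, 0, 0).

Fixpoint walk m (x : 'rV[F]_m) (w : outcome m) (i : nat)
  : 'rV[F]_m * 'rV[F]_m * 'rV[F]_m :=
  match i with
  | 0 => (x, w.1.1, w.1.2)
  | i'.+1 =>
      let: (xi, hi, hi') := walk x w i' in
      let: (s, s', t, t', hn) := stepn w i' in
      (xi + s *: hi + s' *: hi', t *: hi + t' *: hi', hn)
  end.

Definition plane m (f : table m) (x : 'rV[F]_m) (w : outcome m) (i : nat) : table 2 :=
  let: (xi, hi, hi') := walk x w i in restr f xi hi hi'.

Definition Prw p m (E : pred (outcome m)) : R :=
  #|[set w : outcome m | valid p w && E w]|%:R / #|[set w : outcome m | valid p w]|%:R.

End RMDefs.

(* Main.v *)
Require Import Defs.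
From HB Require Import structures.
From mathcomp Require Import all_boot all_order all_algebra all_fingroup all_field.
From mathcomp Require Import mpoly.
From mathcomp Require Import ring lra zify.
Set Implicit Arguments. Unset Strict Implicit. Unset Printing Implicit Defensive.
Import Order.TTheory GRing.Theory Num.Theory.
Local Open Scope ring_scope.

(* If every test passes, each plane P_i carries a codeword Q_i near f; Q_0 differs
   from Q^* because f(x) <> Q^*(x).  A random line of P_i misleads the test (Q_i
   agrees there with Q^*, or f is far there from Q_i) with probability at most 2/|F|:
   the points of a random parametrized line are pairwise independent, so Chebyshev
   applies both to the disagreement set of f and Q_i and to the agreement set of Q_i
   and Q^*.  On a line that does not mislead, Q_i and Q_{i+1} agree, so Q_{i+1} <> Q^*
   there and the induction continues.  As |F| >= 4m, the union bound 1 - 2m/|F| over the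
   steps already dominates (1 - 4/|F|)^m.  At the end f and Q^* are far apart on the last
   line.  But x_m is x plus a uniform F-combination of h'_0, ..., h'_{m-1}, up to an
   independent term; these vectors form a singular matrix with probability at most
   2/|H|, and otherwise x_m is uniform in F^m, so that Markov's inequality bounds the
   probability of this last event.
   Each conditional probability is computed by averaging over the translations of
   the outcome space that change only the coordinates of interest. *)

(** * Averaging and pairwise independent sampling *)

Section Averaging.
Variables (R : realFieldType) (W T : finType) (sh : T -> W -> W) (V : {set W}).
Hypothesis sh_inj : forall t, injective (sh t).
Hypothesis shV : forall t w, (sh t w \in V) = (w \in V).

Lemma sum_shift (G : W -> R) :
  #|T|%:R * \sum_(w in V) G w = \sum_(w in V) \sum_t G (sh t w).
Proof.
rewrite exchange_big /= -sum1_card natr_sum mulr_suml.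
apply: eq_bigr => t _; rewrite mul1r (reindex_inj (sh_inj (t := t))) /=.
by apply: eq_bigl => w; rewrite shV.
Qed.

(** A bound on the average over shifts, uniform in [w], passes to the average over [V]. This
    replaces conditioning on the coordinates that the shifts fix. *)
Lemma sum_shift_le (G : W -> R) (K : R) :
  (forall w, w \in V -> \sum_t G (sh t w) <= K) ->
  #|T|%:R * \sum_(w in V) G w <= #|V|%:R * K.
Proof.
move=> le_K; rewrite sum_shift mulr_natl -sumr_const.
exact: ler_sum.
Qed.
End Averaging.

Lemma natr_card_set (R : realFieldType) (T : finType) (A : {set T}) (P : pred T) :
  #|[set x in A | P x]|%:R = \sum_(x in A) (P x)%:R :> R.
Proof.
rewrite -sum1_card natr_sum big_mkcond [RHS]big_mkcond /=.
by apply: eq_bigr => x _; rewrite inE; case: (x \in A); case: (P x).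
Qed.

Lemma natr_card_pred (R : realFieldType) (T : finType) (P : pred T) :
  #|[set x | P x]|%:R = \sum_x (P x)%:R :> R.
Proof.
rewrite -sum1_card natr_sum big_mkcond /=.
by apply: eq_bigr => x _; rewrite inE; case: (P x).
Qed.

Lemma sum_const_natr (R : realFieldType) (T : finType) (x : R) :
  \sum_(i : T) x = #|T|%:R * x.
Proof. by rewrite sumr_const mulr_natl. Qed.

Section Sampling.
Variables (R : realFieldType) (F : finFieldType) (k : nat) (B : {set 'rV[F]_k}).
Local Notation q := (#|F|%:R : R).
Local Notation n := (#|'rV[F]_k|%:R : R).
Local Notation b := (#|B|%:R : R).

(** Parameters are counted, not points, and [v = 0] is allowed; points at distinct parameters are
    then exactly independent. *)
Definition line_hits (u v : 'rV[F]_k) : R := #|[set l : F | u + l *: v \in B]|%:R.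

Lemma sum_translate (v : 'rV[F]_k) : \sum_u (u + v \in B)%:R = b.
Proof.
transitivity (\sum_u (u \in B)%:R : R).
  by rewrite [RHS](reindex_inj (addIr v)).
by rewrite -natr_card_pred; congr _%:R; apply: eq_card => u; rewrite inE.
Qed.

Lemma sum_dilate (u : 'rV[F]_k) (l : F) : l != 0 ->
  \sum_v (u + l *: v \in B)%:R = b.
Proof.
move=> l0; rewrite -(sum_translate u) [RHS](reindex_inj (scalerI l0)) /=.
by apply: eq_bigr => v _; rewrite addrC.
Qed.

Lemma sum_line_hits : \sum_u \sum_v line_hits u v = n * q * b.
Proof.
under eq_bigr => u _ do under eq_bigr => v _ do rewrite /line_hits natr_card_pred.
under eq_bigr => u _ do rewrite exchange_big.
rewrite exchange_big /=.
under eq_bigr => l _ do (rewrite exchange_big /=;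
  under eq_bigr => v _ do rewrite sum_translate).
by rewrite !sum_const_natr mulrA [q * n]mulrC.
Qed.

Lemma sum_line_hits_sq :
  \sum_u \sum_v line_hits u v ^+ 2 = q * (n * b + (q - 1) * b ^+ 2).
Proof.
transitivity (\sum_(l : F) \sum_(l' : F) \sum_v \sum_u
   ((u + l *: v \in B)%:R * (u + l' *: v \in B)%:R : R)).
  transitivity (\sum_u \sum_v \sum_(l : F) \sum_(l' : F)
     ((u + l *: v \in B)%:R * (u + l' *: v \in B)%:R : R)).
    apply: eq_bigr => u _; apply: eq_bigr => v _.
    rewrite /line_hits natr_card_pred expr2 mulr_suml.
    by apply: eq_bigr => l _; rewrite mulr_sumr.
  under eq_bigr => u _ do (rewrite exchange_big /=;
    under eq_bigr => l _ do rewrite exchange_big /=).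
  rewrite exchange_big /=; apply: eq_bigr => l _.
  rewrite exchange_big /=; apply: eq_bigr => l' _.
  by rewrite exchange_big.
transitivity (\sum_(l : F) (n * b + (q - 1) * b ^+ 2)); last first.
  exact: sum_const_natr.
apply: eq_bigr => l _; rewrite (bigD1 l) //=; congr (_ + _).
  transitivity (\sum_(v : 'rV[F]_k) b); last exact: sum_const_natr.
  apply: eq_bigr => v _; rewrite -(sum_translate (l *: v)).
  by apply: eq_bigr => u _; case: (_ \in B); rewrite ?mulr1 ?mulr0.
transitivity (\sum_(l' : F | l' != l) b ^+ 2); last first.
  rewrite sumr_const cardC1 -[LHS]mulr_natl -subn1 natrB //.
  by apply/card_gt0P; exists l.
apply: eq_bigr => l' l'l.
(* Taking the first point as the new [u] leaves the second at [u + (l' - l) *: v], which is uniform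
   in [v] because [l' != l]. *)
transitivity (\sum_v \sum_u ((u \in B)%:R * (u + (l' - l) *: v \in B)%:R : R)).
  apply: eq_bigr => v _; rewrite [RHS](reindex_inj (addIr (l *: v))) /=.
  by apply: eq_bigr => u _; rewrite scalerBl -addrA (addrC (l *: v)) subrK.
rewrite exchange_big /=.
under eq_bigr => u _ do rewrite -mulr_sumr sum_dilate ?subr_eq0 //.
rewrite -mulr_suml expr2; congr (_ * _).
by rewrite -(sum_translate 0); apply: eq_bigr => u _; rewrite addr0.
Qed.

(** The mean of [line_hits] is [q * b / n]; scaling by [n] clears the denominator, and the first two
    moments give the identity. *)
Lemma line_hits_variance :
  \sum_u \sum_v (n * line_hits u v - q * b) ^+ 2 = n ^+ 2 * q * b * (n - b).
Proof.
transitivity (\sum_u \sum_v (n ^+ 2 * line_hits u v ^+ 2 +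
   (- (2 * n * q * b) * line_hits u v + q ^+ 2 * b ^+ 2))).
  by apply: eq_bigr => u _; apply: eq_bigr => v _; ring.
under eq_bigr => u _ do rewrite !big_split -!mulr_sumr /=.
rewrite !big_split -!mulr_sumr /= sum_line_hits_sq sum_line_hits.
by rewrite !sum_const_natr; ring.
Qed.

(* Chebyshev: the points of a uniformly random parametrized line are pairwise independent. *)
Lemma line_sampling (t : R) : q * b <= n * t ->
  (\sum_u \sum_v (t <= line_hits u v)%R%:R) * (n * t - q * b) ^+ 2
     <= n ^+ 2 * q * b * (n - b).
Proof.
move=> ht; rewrite -line_hits_variance mulr_suml.
apply: ler_sum => u _; rewrite mulr_suml; apply: ler_sum => v _.
case: (lerP t) => [h|_]; last by rewrite mul0r sqr_ge0.
rewrite mul1r lerXn2r // ?nnegrE ?subr_ge0 //.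
  by apply: (le_trans ht); rewrite ler_wpM2l.
by rewrite lerB // ler_wpM2l.
Qed.
End Sampling.

(** * Reed-Muller codes on lines and planes *)

Section ReedMuller.
Variable F : finFieldType.

Lemma RMP k d (g : table F k) : reflect (is_RM d g) (g \in RM F k d).
Proof.
rewrite inE /Defs.decP.
by apply: (iffP idP); case: (ClassicalDescription.excluded_middle_informative _).
Qed.

Lemma RM0 k d : 0 \in RM F k d.
Proof.
apply/RMP; exists 0; split; first by rewrite msize0.
by move=> x; rewrite meval0 ffunE.
Qed.

Lemma size_monomial_comp k (P : 'I_k -> {poly F}) (mm : 'I_k -> nat) :
  (forall i, size (P i) <= 2)%N -> (size (\prod_i P i ^+ mm i)%R <= (\sum_i mm i).+1)%N.
Proof.
move=> hP; elim/big_rec2: _ => [|i n p _ IH]; first by rewrite size_poly1.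
apply: leq_trans (size_polyMleq _ _) _.
have := size_poly_exp_leq (P i) (mm i).
have : ((size (P i)).-1 * mm i <= mm i)%N.
  by rewrite -{2}[mm i]mul1n leq_mul2r -ltnS; have := hP i; lia.
lia.
Qed.

Lemma msize_monomial_comp k n (P : 'I_k -> {mpoly F[n]}) (mm : 'I_k -> nat) :
  (forall i, msize (P i) <= 2)%N -> (msize (\prod_i P i ^+ mm i)%R <= (\sum_i mm i).+1)%N.
Proof.
move=> hP.
have leM (p r : {mpoly F[n]}) a b : (msize p <= a.+1)%N -> (msize r <= b.+1)%N ->
    (msize (p * r)%R <= (a + b).+1)%N.
  move=> hp hr; have [->|p0] := eqVneq p 0; first by rewrite mul0r msize0.
  have [->|r0] := eqVneq r 0; first by rewrite mulr0 msize0.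
  by rewrite msizeM // -subn1 leq_subLR (leq_trans (leq_add hp hr)) // addSn addnS.
elim/big_rec2: _ => [|i s p _ IH]; first by rewrite msize1.
apply: (leM _ _ _ _) => //; elim: (mm i) => [|e IHe]; first by rewrite expr0 msize1.
by rewrite exprS; apply: (leM _ _ 1%N).
Qed.

Lemma RM_line k d (g : table F k) (u v : 'rV[F]_k) : g \in RM F k d ->
  exists2 P : {poly F}, (size P <= d.+1)%N & forall l, g (u + l *: v) = P.[l].
Proof.
case/RMP=> Q [sQ gQ].
exists (\sum_(mm <- msupp Q) Q@_mm *:
          \prod_i ((v ord0 i) *: 'X + (u ord0 i)%:P) ^+ mm i).
  rewrite big_seq; apply: leq_trans (size_sum _ _ _) _.
  apply/bigmax_leqP_seq => mm _ hm.
  apply: leq_trans (size_scale_leq _ _) _.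
  apply: leq_trans (size_monomial_comp _ _) _ => [i|].
    apply: leq_trans (size_polyD _ _) _; rewrite geq_max size_polyC.
    by rewrite (leq_trans (size_scale_leq _ _)) ?size_polyX //; case: (_ == _).
  by rewrite -mdegE; apply: leq_trans (msize_mdeg_lt hm) _.
move=> l; rewrite gQ mevalE horner_sum; apply: eq_bigr => mm _.
rewrite hornerZ horner_prod; congr (_ * _); apply: eq_bigr => i _.
by rewrite horner_exp !hornerE !mxE; congr (_ ^+ _); ring.
Qed.

Lemma RM_restr k d (f : table F k) (a h h' : 'rV[F]_k) :
  f \in RM F k d -> restr f a h h' \in RM F 2 d.
Proof.
case/RMP=> Q [sQ fQ]; apply/RMP.
(* Substituting affine forms for the variables does not raise the total degree. *)
pose lq : k.-tuple {mpoly F[2]} := [tuple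
  (a ord0 i)%:MP + h ord0 i *: 'X_ord0 + h' ord0 i *: 'X_(lift ord0 ord0) | i < k].
exists (Q \mPo lq); split.
  rewrite comp_mpolyE big_seq; apply: leq_trans (msize_sum _ _ _) _.
  apply/bigmax_leqP_seq => mm _ hm.
  apply: leq_trans (msizeZ_le _ _) _.
  apply: leq_trans (msize_monomial_comp _ _) _ => [i|].
    have hX c j : (msize (c *: 'X_j : {mpoly F[2]}) <= 2)%N.
      by rewrite (leq_trans (msizeZ_le _ _)) // msizeX mdeg1.
    rewrite tnth_mktuple (leq_trans (msizeD_le _ _)) // geq_max hX andbT.
    rewrite (leq_trans (msizeD_le _ _)) // geq_max hX andbT msizeC.
    by case: (_ == _).
  by rewrite -mdegE; apply: leq_trans (msize_mdeg_lt hm) _.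
move=> x; rewrite ffunE fQ comp_mpoly_meval; apply: meval_eq => i.
rewrite tnth_mktuple !mevalD !mevalZ mevalC !mevalXU !mxE.
by ring.
Qed.

(** A univariate polynomial of degree at most [d] with more than [d] roots is zero. The two
    parametrized lines may differ, since one line of the walk is seen in the coordinates of two
    consecutive planes. *)
Lemma RM_line_agree k d (g g' : table F k) (u v u' v' : 'rV[F]_k) :
  g \in RM F k d -> g' \in RM F k d ->
  (d < #|[set l : F | g (u + l *: v)%R == g' (u' + l *: v')%R]|)%N ->
  forall l, g (u + l *: v) = g' (u' + l *: v').
Proof.
move=> /(RM_line u v)[P sP gP] /(RM_line u' v')[P' sP' gP'] hd l.
suff /eqP : P - P' == 0 by rewrite gP gP' => /subr0_eq ->.
apply: contraTT hd => P0; rewrite -leqNgt.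
rewrite cardE; apply: (@leq_trans (size (P - P')%R).-1); last first.
  have : (size (P - P')%R <= d.+1)%N.
    by rewrite (leq_trans (size_polyD _ _)) // geq_max size_polyN sP sP'.
  lia.
rewrite -ltnS prednK ?size_poly_gt0 //; apply: max_poly_roots P0 _ (enum_uniq _).
apply/allP => y; rewrite mem_enum inE gP gP' => /eqP e.
by rewrite rootE !hornerE e subrr.
Qed.

(* Schwartz-Zippel on the lines through a point where g and g' differ. *)
Lemma RM_agree_card k d (g g' : table F k) :
  g \in RM F k d -> g' \in RM F k d -> g != g' ->
  (#|[set x | g x == g' x]| * (#|F| - 1) <= #|'rV[F]_k| * d)%N.
Proof.
move=> gRM g'RM /eqP neq.
have [u neu] : exists u, g u != g' u.
  apply/existsP; apply/contraT; rewrite negb_exists => /forallP h.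
  by case: neq; apply/ffunP => x; apply/eqP; have := h x; rewrite negbK.
set Z := [set x | _].
have -> : (#|F| - 1 = #|[set l : F | l != 0%R]|)%N.
  rewrite (_ : [set l : F | _] = ~: [set 0]); first by rewrite cardsC1 subn1.
  by apply/setP => l; rewrite !inE.
(* Double counting: for fixed [l != 0], the point [u + l *: v] runs once over the whole space as [v]
   does. *)
have -> : (#|Z| * #|[set l : F | l != 0%R]| =
   \sum_(v : 'rV[F]_k) #|[set l : F | (l != 0%R) && (u + l *: v \in Z)%R]|)%N.
  under eq_bigr => v _ do rewrite -sum1_card big_mkcond.
  rewrite exchange_big /= mulnC -sum_nat_const [LHS]big_mkcond /=.
  apply: eq_bigr => l _; rewrite inE; have [->|l0] := eqVneq l 0.
    by rewrite big1 // => v _; rewrite inE eqxx.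
  rewrite -sum1_card big_mkcond /= (reindex_inj (addrI u)) /=.
  rewrite (reindex_inj (scalerI l0)) /=; apply: eq_bigr => v _.
  by rewrite !inE l0.
rewrite -sum_nat_const; apply: leq_sum => v _; rewrite leqNgt; apply/negP => hd.
(* More than [d] agreements on a line through [u] would force agreement at [l = 0], that is, at
   [u]. *)
suff /(RM_line_agree gRM g'RM)/(_ 0) :
    (d < #|[set l : F | g (u + l *: v)%R == g' (u + l *: v)%R]|)%N.
  by rewrite scale0r addr0 => /eqP; rewrite (negPf neu).
apply: leq_trans hd _; apply: subset_leq_card; apply/subsetP => l.
by rewrite !inE => /andP[].
Qed.
End ReedMuller.

(** * Misleading lines *)

Section BadLines.
Variables (R : realFieldType) (F : finFieldType) (d : nat).
Hypotheses (q_ge8 : (8 <= #|F|)%N) (d4_le_q : (4 * d <= #|F|)%N).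
Local Notation q := (#|F|%:R : R).

Let q8 : (8 : R) <= q. Proof. by rewrite ler_nat. Qed.
Let d4 : 4 * d%:R <= q. Proof. by rewrite -natrM ler_nat. Qed.
Let d0 : 0 <= d%:R :> R. Proof. exact: ler0n. Qed.
Let n_def : #|'rV[F]_2|%:R = q ^+ 2. Proof. by rewrite card_mx mul1n natrX. Qed.

(** The radius is delta/4 in relative distance: a weighted distance below rho <= delta/8 gives the
    whole plane weight one half. *)
Definition near_codeword (g c : table F 2) : bool :=
  (c \in RM F 2 d) && (4 * #|[set x | g x != c x]| <= (#|F| - d) * #|F|)%N.

(* The near codeword c is unique, so the existential only names the decoding of g. *)
Definition bad_line (g Q : table F 2) (u v : 'rV[F]_2) : bool :=
  [exists c, [&& near_codeword g c, c != Q &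
    [forall l : F, c (u + l *: v) == Q (u + l *: v)]
    || (3 * (#|F| - d) < 4 * #|[set l : F | g (u + l *: v)%R != c (u + l *: v)%R]|)%N]].

Lemma near_codeword_uniq (g c c' : table F 2) :
  near_codeword g c -> near_codeword g c' -> c = c'.
Proof.
move=> /andP[cRM hc] /andP[c'RM hc']; apply/eqP/contraT => neq.
have := RM_agree_card cRM c'RM neq.
have : (#|'rV[F]_2| <= #|[set x | c x == c' x]| + #|[set x | g x != c x]|
     + #|[set x | g x != c' x]|)%N.
  rewrite -cardsT.
  set A := [set x | _]; set B := [set x | _]; set C := [set x | _].
  have hAB := leq_of_leqif (leq_card_setU A B).
  have hABC := leq_of_leqif (leq_card_setU (A :|: B) C).
  apply: leq_trans (subset_leq_card _) (leq_trans hABC _); last by rewrite leq_add2r.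
  apply/subsetP => x _; rewrite !inE.
  by case: (g x =P c x) => [<-|]; case: (g x == c' x); rewrite ?orbT.
rewrite card_mx mul1n; move: hc hc' q_ge8 d4_le_q.
move: #|F| #|[set x | c x == c' x]| #|[set x | g x != c x]| #|[set x | g x != c' x]|.
move=> Q z b b' hb hb' Q8 Qd hn hz.
(* Each codeword misses [g] on at most a quarter of [(Q - d) * Q] points. The resulting agreement
   exceeds the bound [Q ^ 2 * d / (Q - 1)] for distinct codewords. *)
have : (Q ^ 2 + Q * d <= 2 * z)%N by nia.
nia.
Qed.

(** Chebyshev at threshold [q]: an agreement set of density at most 2/7 contains a random line with
    probability at most (2/7)/(5/7)/q = 2/(5q). *)
Lemma agree_line_count (c Q : table F 2) :
  c \in RM F 2 d -> Q \in RM F 2 d -> c != Q ->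
  (\sum_u \sum_v [forall l : F, c (u + l *: v) == Q (u + l *: v)]%:R) * 5 <= 2 * q ^+ 3.
Proof.
move=> cRM QRM neq; set Z := [set x | c x == Q x].
have := RM_agree_card cRM QRM neq.
rewrite -/Z card_mx mul1n -(ler_nat R) !natrM natrB ?(leq_trans _ q_ge8) // ?natrX.
have := @line_sampling R F 2 Z q; rewrite n_def.
set z : R := #|Z|%:R; have z0 : 0 <= z by exact: ler0n.
set S := \sum_u _ => hS hz.
have [h8 h4 h0] := And3 q8 d4 d0.
have q0 : 0 < q by lra.
(* From [z * (q - 1) <= q ^+ 2 * d], with [d <= q / 4] and [q - 1 >= 7 * q / 8]. *)
have hz7 : 7 * z <= 2 * q ^+ 2.
  rewrite -(ler_pM2r q0).
  have h1 : 0 <= z * (q - 8) by rewrite mulr_ge0 // subr_ge0.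
  have h2 : 0 <= q * q * (q - 4 * d%:R) by rewrite !mulr_ge0 ?subr_ge0 // ltW.
  nra.
have -> : \sum_u \sum_v [forall l : F, c (u + l *: v) == Q (u + l *: v)]%:R = S.
  apply: eq_bigr => u _; apply: eq_bigr => v _; congr (nat_of_bool _)%:R.
  rewrite ler_nat; apply/forallP/idP => [h|].
    by rewrite -cardsT subset_leq_card //; apply/subsetP => l _; rewrite !inE.
  move=> h l; have /eqP : [set l : F | u + l *: v \in Z] == setT.
    by rewrite eqEcard subsetT cardsT.
  by move/setP/(_ l); rewrite !inE.
have S0 : 0 <= S by apply: sumr_ge0 => u _; apply: sumr_ge0 => v _.
have q2 : 0 < q ^+ 2 by rewrite exprn_gt0.
have zq2 : 0 < q ^+ 2 - z by lra.
have {}hS : S * (q ^+ 2 - z) <= q ^+ 3 * z.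
  have lt : 0 < q ^+ 2 * (q ^+ 2 - z) by rewrite mulr_gt0.
  rewrite -(ler_pM2r lt).
  have -> : S * (q ^+ 2 - z) * (q ^+ 2 * (q ^+ 2 - z)) = S * (q ^+ 2 * q - q * z) ^+ 2 by ring.
  apply: le_trans (hS _) _.
    have -> : q ^+ 2 * q = q * q ^+ 2 by ring.
    by rewrite ler_pM2l //; lra.
  by rewrite le_eqVlt; apply/orP; left; apply/eqP; ring.
have q3 : 0 < q ^+ 3 by rewrite exprn_gt0.
rewrite -(ler_pM2r zq2).
have h : 0 <= q ^+ 3 * (2 * q ^+ 2 - 7 * z) by rewrite mulr_ge0 ?subr_ge0 // ltW.
nra.
Qed.

(** The mean number of disagreements on a line is at most (q-d)/4, so passing 3(q-d)/4 is a
    deviation of at least (q-d)/2. Chebyshev bounds its probability by 1/(q-d) <= 4/(3q). *)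
Lemma far_line_count (g c : table F 2) :
  near_codeword g c ->
  (\sum_u \sum_v (3 * (#|F| - d) <
     4 * #|[set l : F | g (u + l *: v)%R != c (u + l *: v)%R]|)%N%:R) * 3 <= 4 * q ^+ 3.
Proof.
move=> /andP[_]; set B := [set x | _].
have dq : (d <= #|F|)%N by lia.
rewrite -(ler_nat R) !natrM natrB //.
have [h8 h4 h0] := And3 q8 d4 d0.
set D : R := q - d%:R => hb.
have := @line_sampling R F 2 B (3 / 4 * D); rewrite n_def.
move: hb; set b : R := #|B|%:R => hb.
have b0 : 0 <= b by exact: ler0n.
set S := \sum_u _ => hS; set S' := \sum_u _.
have S'S : S' <= S.
  apply: ler_sum => u _; apply: ler_sum => v _; rewrite ler_nat.
  have [h|//] := boolP (3 * _ < _)%N.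
  suff -> : 3 / 4 * D <= line_hits R B u v by [].
  move: h; rewrite -(ltr_nat R) !natrM natrB // -/D => h.
  suff : #|[set l : F | g (u + l *: v) != c (u + l *: v)]|%:R = line_hits R B u v by lra.
  by congr _%:R; apply: eq_card => l; rewrite !inE.
have S0 : 0 <= S by apply: sumr_ge0 => u _; apply: sumr_ge0 => v _.
have q0 : 0 < q by lra.
have D0 : 0 < D by rewrite /D; lra.
have Dq : 3 * q <= 4 * D by rewrite /D; lra.
have qD : 0 < q * D by rewrite mulr_gt0.
have he : q ^+ 2 * D / 2 <= q ^+ 2 * (3 / 4 * D) - q * b.
  have h : 0 <= q * (D * q - 4 * b) by rewrite mulr_ge0 ?subr_ge0 // ltW.
  nra.
have {}hS : S * (q ^+ 2 * D / 2) ^+ 2 <= q ^+ 8 * D / 4.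
  apply: le_trans (_ : S * (q ^+ 2 * (3 / 4 * D) - q * b) ^+ 2 <= _).
    rewrite ler_wpM2l // lerXn2r // nnegrE.
      by rewrite !mulr_ge0 ?exprn_ge0 ?invr_ge0 // ltW.
    by apply: le_trans he; rewrite !mulr_ge0 ?exprn_ge0 ?invr_ge0 // ltW.
  apply: le_trans (hS _) _.
    by have : 0 <= q ^+ 2 * D / 2 by [rewrite !mulr_ge0 ?exprn_ge0 ?invr_ge0 // ltW]; lra.
  apply: le_trans (_ : q ^+ 7 * b <= _).
    have h : 0 <= q ^+ 5 * b ^+ 2 by rewrite mulr_ge0 ?exprn_ge0 // ltW.
    have -> : (q ^+ 2) ^+ 2 * q * b * (q ^+ 2 - b) = q ^+ 7 * b - q ^+ 5 * b ^+ 2 by ring.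
    lra.
  have h : 0 <= q ^+ 7 * (D * q - 4 * b) by rewrite mulr_ge0 ?subr_ge0 ?exprn_ge0 // ltW.
  have -> : q ^+ 8 * D / 4 = q ^+ 7 * (D * q - 4 * b) / 4 + q ^+ 7 * b by field.
  lra.
have SD : S * D <= q ^+ 4.
  have lt : 0 < q ^+ 4 * D by rewrite mulr_gt0 ?exprn_gt0.
  rewrite -(ler_pM2r lt).
  have -> : S * D * (q ^+ 4 * D) = 4 * (S * (q ^+ 2 * D / 2) ^+ 2) by field.
  have -> : q ^+ 4 * (q ^+ 4 * D) = 4 * (q ^+ 8 * D / 4) by field.
  by rewrite ler_pM2l.
apply: le_trans (_ : S * 3 <= _); first by rewrite ler_wpM2r.
rewrite -(ler_pM2r q0).
have h : 0 <= S * (4 * D - 3 * q) by rewrite mulr_ge0 ?subr_ge0.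
have -> : 4 * q ^+ 3 * q = 4 * q ^+ 4 by ring.
lra.
Qed.

(** By uniqueness only one near codeword matters, and 2/5 + 4/3 < 2. *)
Lemma bad_line_count (g Q : table F 2) : Q \in RM F 2 d ->
  \sum_u \sum_v (bad_line g Q u v)%:R <= 2 * q ^+ 3.
Proof.
move=> QRM.
have q3 : 0 <= q ^+ 3 by rewrite exprn_ge0.
have [[c hc]|none] := pickP [pred c | near_codeword g c && (c != Q)]; last first.
  rewrite big1 ?mulr_ge0 // => u _; rewrite big1 // => v _.
  rewrite /bad_line; case: existsP => // -[c /and3P[h1 h2 _]].
  by have := none c; rewrite /= h1 h2.
case/andP: hc => hc neq.
have := agree_line_count (proj1 (andP hc)) QRM neq.
have := far_line_count hc.
set S2 := \sum_u _; set S1 := \sum_u _ => h2 h1.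
suff : \sum_u \sum_v (bad_line g Q u v)%:R <= S1 + S2 by lra.
rewrite /S1 /S2 -big_split /=; apply: ler_sum => u _.
rewrite -big_split /=; apply: ler_sum => v _.
rewrite -natrD ler_nat /bad_line; case: existsP => // -[c' /and3P[hc' _]].
rewrite (near_codeword_uniq hc' hc).
by case: [forall l, _] => //= ->.
Qed.
End BadLines.

(** * Singular matrices over the prime field *)

(** Moves matrices with entries in H to ['F_p], where the order of the general linear group is
    available. *)
Lemma prime_subfield_embedding (F : finFieldType) (p : nat) : p \in [pchar F] ->
  exists phi : {rmorphism 'F_p -> F}, forall a, phi a = (a : nat)%:R.
Proof.
move=> chF.
pose phi : {rmorphism 'F_p -> pPrimeCharType chF} := GRing.in_alg (pPrimeCharType chF).
exists phi => a.
exact: mulr1.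
Qed.

Section Singular.
Variable (R : realFieldType).

(** After division by the power of [p], a lower bound on the product of the 1 - p^(-i) for i from 1
    to n+1. The term [p%:R ^- n.+1] is the slack that makes the induction close. *)
Lemma prod_pow_pred_ge (p n : nat) : (1 < p)%N ->
  p%:R ^+ 'C(n.+2, 2) * (1 - 2 / p%:R + p%:R ^- n.+1)
    <= (\prod_(1 <= i < n.+2) (p ^ i - 1))%N%:R :> R.
Proof.
move=> p1; have p0 : (0 < p)%N by apply: ltnW.
have p2 : (2 : R) <= p%:R by rewrite ler_nat.
have pR : 0 < p%:R :> R by lra.
elim: n => [|n IH].
  rewrite big_nat1 expn1 natrB // expr1 /=.
  have -> : p%:R * (1 - 2 / p%:R + p%:R ^- 1) = p%:R - 1 :> R by field; lra.
  by [].
rewrite big_nat_recr //= natrM natrB ?expn_gt0 ?p0 // natrX.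
set P : R := p%:R in p2 pR IH *; set y := P ^- n.+1 in IH.
have y0 : 0 < y by rewrite invr_gt0 exprn_gt0.
have Pn : P ^+ n.+1 != 0 by rewrite expf_neq0 // lt0r_neq0.
have PN : P ^+ n.+2 = P / y by rewrite /y invrK exprS.
have y1 : y * P <= 1.
  by rewrite /y exprSr invfM mulfVK ?lt0r_neq0 // invf_le1 ?exprn_gt0 // exprn_ege1 //; lra.
have z2 : 2 / P <= 1 by rewrite ler_pdivrMr // mul1r.
have -> : P ^- n.+2 = y / P by rewrite PN invf_div.
have ge1 : 1 <= P ^+ n.+2 by rewrite exprn_ege1 //; lra.
apply: le_trans (ler_wpM2r _ IH); last by rewrite subr_ge0.
have -> : P ^+ 'C(n.+3, 2) = P ^+ n.+2 * P ^+ 'C(n.+2, 2).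
  by rewrite -exprD binS bin1 addnC.
have -> : P ^+ n.+2 - 1 = P ^+ n.+2 * (1 - y / P) by rewrite PN; field; rewrite !lt0r_neq0.
have A0 : 0 <= P ^+ n.+2 * P ^+ 'C(n.+2, 2) by rewrite mulr_ge0 ?exprn_ge0 // ltW.
(* With z = y/P, the gain (1 - 2/P + y)(1 - z) - (1 - 2/P + z) equals (y - 2z) + (2/P - y)z; both
   terms are nonnegative. *)
have yP : y / P <= y / 2 by rewrite ler_pM2l // lef_pV2 ?posrE.
have yP0 : 0 < y / P by rewrite divr_gt0.
have h : 0 <= (2 / P - y) * (y / P).
  by rewrite mulr_ge0 ?(ltW yP0) // subr_ge0 ler_pdivlMr //; lra.
set c := P ^+ 'C(_, _) in A0 *; set A := P ^+ _ in A0 *; set z := y / P in yP yP0 h *.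
rewrite -subr_ge0 (_ : _ - _ = A * c * ((1 - 2 / P + y) * (1 - z) - (1 - 2 / P + z))).
  by rewrite mulr_ge0 //; lra.
by ring.
Qed.

Lemma card_singular (p n : nat) : prime p -> (0 < n)%N ->
  #|[set N : 'M['F_p]_n | N \notin unitmx]|%:R <= 2 / p%:R * #|'M['F_p]_n|%:R :> R.
Proof.
case: n => // n pr _; have p1 := prime_gt1 pr.
have cGL : #|[set N : 'M['F_p]_n.+1 | N \in unitmx]| = #|'GL_(n.+1)['F_p]%g|.
  rewrite cardsT card_sub; apply: eq_card => N; rewrite inE; exact: (unitmxE N).
have := card_GL 'F_p (ltn0Sn n); rewrite -cGL card_Fp // => hGL.
have := cardsC [set N : 'M['F_p]_n.+1 | N \in unitmx].
rewrite hGL => hC.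
have -> : [set N : 'M['F_p]_n.+1 | N \notin unitmx] = ~: [set N | N \in unitmx].
  by apply/setP => N; rewrite !inE.
move/(congr1 (fun k => k%:R : R)): hC; rewrite natrD natrM natrX.
have -> : #|'M['F_p]_n.+1|%:R = p%:R ^+ 'C(n.+1, 2) * p%:R ^+ 'C(n.+2, 2) :> R.
  rewrite card_mx card_Fp // natrX -exprD; congr (_ ^+ _).
  (* The square of n+1 is the sum of the binomials C(n+1,2) and C(n+2,2). *)
  elim: (n) => // k IH.
  have := binS k.+2 1; have := binS k.+1 1; rewrite !bin1; nia.
have := prod_pow_pred_ge n p1.
set c := #|~: _|%:R; set X := (\prod_(_ <= _ < _) _)%N%:R.
set y := _ ^- _; set a := _ ^+ _; set b := _ ^+ _.
move=> hX hc.
have pR : 0 < p%:R :> R by rewrite ltr0n ltnW.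
have a0 : 0 < b by rewrite exprn_gt0.
have y0 : 0 < y by rewrite invr_gt0 exprn_gt0.
have : b * (a * (1 - 2 / p%:R)) <= b * X.
  rewrite ler_pM2l //; apply: le_trans hX.
  by rewrite ler_pM2l ?exprn_gt0 // lerDl ltW.
nra.
Qed.
End Singular.

(** * The walk and translations of its outcomes *)

Section Walk.
Variables (F : finFieldType) (m : nat).
Implicit Types (w : outcome F m) (x : 'rV[F]_m) (f : table F m).

Definition vec2 (a b : F) : 'rV[F]_2 := \row_j (if j == ord0 then a else b).
(** With [line_dir], the line of step i+1 in the coordinates of the plane P_i. *)
Definition line_base w (i : nat) : 'rV[F]_2 :=
  let st := stepn w i in vec2 st.1.1.1.1 st.1.1.1.2.
Definition line_dir w (i : nat) : 'rV[F]_2 :=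
  let st := stepn w i in vec2 st.1.1.2 st.1.2.
Definition second_dir w (i : nat) : 'rV[F]_m :=
  if i is j.+1 then (stepn w j).2 else w.1.2.

Lemma vec2K (v : 'rV[F]_2) : vec2 (v ord0 ord0) (v ord0 (lift ord0 ord0)) = v.
Proof.
apply/rowP => j; rewrite mxE; case: (j =P ord0) => [->//|].
by case: (unliftP ord0 j) => [k ->|->//] _; rewrite (ord1 k).
Qed.

Lemma stepnD w w' i : stepn (w + w') i = stepn w i + stepn w' i.
Proof.
rewrite /stepn; case: insub => [j|]; first by rewrite ffunE.
exact: (esym (addr0 _)).
Qed.

Lemma stepn_ord w (i : 'I_m) : stepn w i = w.2 i.
Proof. by rewrite /stepn valK. Qed.

Lemma walkS x w i : walk x w i.+1 =
  let: r := walk x w i in let: st := stepn w i in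
  (r.1.1 + st.1.1.1.1 *: r.1.2 + st.1.1.1.2 *: r.2, st.1.1.2 *: r.1.2 + st.1.2 *: r.2, st.2).
Proof. by move=> /=; case: (walk x w i) => [[? ?] ?]; case: (stepn w i) => [[[[? ?] ?] ?] ?]. Qed.

Lemma walk_second_dir x w i : (walk x w i).2 = second_dir w i.
Proof. by case: i => // i; rewrite walkS. Qed.

Lemma eq_walk x w w' i : w.1 = w'.1 ->
  (forall j, (j < i)%N -> stepn w j = stepn w' j) -> walk x w i = walk x w' i.
Proof.
move=> h0; elim: i => [|i IH] h; first by rewrite /= h0.
by rewrite !walkS IH ?h // => j ji; apply: h; apply: ltnW.
Qed.

Lemma planeE f x w i (v : 'rV[F]_2) : plane f x w i v =
  f ((walk x w i).1.1 + v ord0 ord0 *: (walk x w i).1.2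
      + v ord0 (lift ord0 ord0) *: (walk x w i).2).
Proof. by rewrite /plane; case: (walk x w i) => [[? ?] ?]; rewrite ffunE. Qed.

Lemma plane_origin f x w : plane f x w 0 0 = f x.
Proof. by rewrite planeE !mxE !scale0r !addr0. Qed.

Lemma plane_axis f x w i (l : F) :
  plane f x w i (vec2 l 0) = f ((walk x w i).1.1 + l *: (walk x w i).1.2).
Proof. by rewrite planeE !mxE /= scale0r addr0. Qed.

(** The axis of P_{i+1} is a line of P_i; decoded information passes between consecutive planes
    through it. *)
Lemma plane_step f x w i (l : F) :
  plane f x w i.+1 (vec2 l 0) = plane f x w i (line_base w i + l *: line_dir w i).
Proof.
rewrite plane_axis walkS planeE !mxE /=; congr (f _).
by rewrite scalerDr !scalerDl !scalerA -!addrA; congr (_ + (_ + _)); rewrite addrCA.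
Qed.

Lemma plane_RM d f x w i : f \in RM F m d -> plane f x w i \in RM F 2 d.
Proof. by move=> fRM; rewrite /plane; case: (walk x w i) => [[? ?] ?]; exact: RM_restr. Qed.

(** Outcomes form an additive group. This translation changes only the four scalars of step i, so it
    moves the line chosen in P_i but not P_i itself. *)
Definition line_shift (i : 'I_m) (t : 'rV[F]_2 * 'rV[F]_2) : outcome F m :=
  (0, 0, [ffun j => if j == i then
     (t.1 ord0 ord0, t.1 ord0 (lift ord0 ord0), t.2 ord0 ord0, t.2 ord0 (lift ord0 ord0), 0)
     else 0]).

Lemma stepn_line_shift (i : 'I_m) t (j : nat) : j != i :> nat -> stepn (line_shift i t) j = 0.
Proof.
by rewrite /stepn; case: insubP => //= k _ <- ki; rewrite ffunE -val_eqE /= (negPf ki).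
Qed.

Lemma line_base_shift (i : 'I_m) t w : line_base (w + line_shift i t) i = line_base w i + t.1.
Proof.
rewrite /line_base stepnD !stepn_ord /= ffunE eqxx -[t.1 in RHS]vec2K.
by apply/rowP => j; rewrite !mxE; case: (_ == _).
Qed.

Lemma line_dir_shift (i : 'I_m) t w : line_dir (w + line_shift i t) i = line_dir w i + t.2.
Proof.
rewrite /line_dir stepnD !stepn_ord /= ffunE eqxx -[t.2 in RHS]vec2K.
by apply/rowP => j; rewrite !mxE; case: (_ == _).
Qed.

Lemma plane_line_shift f x w (i : 'I_m) t :
  plane f x (w + line_shift i t) i = plane f x w i.
Proof.
rewrite /plane (_ : walk x _ i = walk x w i) //; apply: eq_walk => [|j ji].
  by case: w => -[h h'] s /=; congr (_, _); rewrite /= addr0.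
by rewrite stepnD stepn_line_shift ?addr0 // ltn_eqF.
Qed.

(** Only the scalars s'_j move: all directions stay fixed, and x_m moves by the combination of the
    h'_j with coefficients [c]. *)
Definition point_shift (c : 'rV[F]_m) : outcome F m :=
  (0, 0, [ffun j => (0, c ord0 j, 0, 0, 0)]).

Definition dir_matrix w : 'M[F]_m := \matrix_(i < m) second_dir w i.

Lemma second_dirD w w' i : second_dir (w + w') i = second_dir w i + second_dir w' i.
Proof. by case: i => [|i] //=; rewrite stepnD. Qed.

Lemma second_dir_point_shift c w i : second_dir (w + point_shift c) i = second_dir w i.
Proof.
rewrite second_dirD; case: i => [|i] /=; first by rewrite addr0.
by rewrite /stepn; case: insub => [j|]; rewrite ?ffunE addr0.
Qed.

Lemma walk_point_shift c x w (i : nat) : (i <= m)%N ->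
  walk x (w + point_shift c) i =
  ((walk x w i).1.1 + \sum_(j < m | (j < i)%N) c ord0 j *: second_dir w j,
   (walk x w i).1.2, (walk x w i).2).
Proof.
elim: i => [|i IH] im.
  rewrite big_pred0 //= addr0; by case: w => -[h h'] s /=; rewrite !addr0.
rewrite !walkS IH ?(ltnW im) // stepnD.
pose io := Ordinal im.
have -> : stepn (point_shift c) i = (0, c ord0 io, 0, 0, 0).
  by rewrite (stepn_ord _ io) ffunE.
rewrite /= !addr0; congr (_, _, _).
rewrite [in RHS](bigD1 io) //= (walk_second_dir x w i) scalerDl.
have -> : \sum_(j < m | (j < i.+1)%N && (j != io)) c ord0 j *: second_dir w j =
    \sum_(j < m | (j < i)%N) c ord0 j *: second_dir w j.
  by apply: eq_bigl => j; rewrite -(inj_eq val_inj) /= ltnS ltn_neqAle andbC.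
set S := \sum_(_ | _) _; rewrite -!addrA; congr (_ + _).
by rewrite addrC -!addrA; congr (_ + (_ + _)).
Qed.

Lemma walk_point_shift_end c x w :
  (walk x (w + point_shift c) m).1 = ((walk x w m).1.1 + c *m dir_matrix w, (walk x w m).1.2).
Proof.
rewrite walk_point_shift //=; congr (_ + _, _); rewrite mulmx_sum_row.
by apply: eq_big => [j|j _]; rewrite ?ltn_ord // rowK.
Qed.

Lemma dir_matrix_point_shift c w : dir_matrix (w + point_shift c) = dir_matrix w.
Proof. by apply/row_matrixP => i; rewrite !rowK second_dir_point_shift. Qed.

Section PrimeField.
Variables (p : nat) (pr : prime p) (phi : {rmorphism 'F_p -> F}).
Hypothesis phiE : forall a, phi a = (a : nat)%:R.

Lemma HsetP (y : F) : reflect (exists a, y = phi a) (y \in Hset F p).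
Proof.
rewrite inE; apply: (iffP existsP) => -[a].
  by move/eqP->; exists a%:R; rewrite rmorph_nat.
have lt : (a < p)%N by have := ltn_ord a; rewrite {2}Fp_cast.
by move->; exists (Ordinal lt); rewrite phiE.
Qed.

Lemma Hset_phi_add (a : 'F_p) (y : F) : (y + phi a \in Hset F p) = (y \in Hset F p).
Proof.
apply/HsetP/HsetP => -[b].
  by move/(canRL (addrK _)) => ->; exists (b - a); rewrite rmorphB.
by move=> ->; exists (b + a); rewrite rmorphD.
Qed.

Lemma inHm_phi_add (v : 'rV['F_p]_m) (h : 'rV[F]_m) :
  inHm p (h + map_mx phi v) = inHm p h.
Proof. by apply: eq_forallb => i; rewrite !mxE Hset_phi_add. Qed.

Definition prime_row (N : 'M['F_p]_m) (i : nat) : 'rV['F_p]_m :=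
  if insub i is Some k then row k N else 0.

(* Row i of N is added to h'_i for i < m; prime_row N m = 0 leaves the unused h'_m alone. *)
Definition dir_shift (N : 'M['F_p]_m) : outcome F m :=
  (0, map_mx phi (prime_row N 0), [ffun j : 'I_m => (0, 0, 0, 0, map_mx phi (prime_row N j.+1))]).

Lemma inHm_add0 (h : 'rV[F]_m) : inHm p (h + 0) = inHm p h.
Proof. by rewrite addr0. Qed.

Lemma valid_line_shift i t w : valid p (w + line_shift i t) = valid p w.
Proof.
rewrite /valid /= !inHm_add0; congr [&& _, _ & _]; apply: eq_forallb => j.
by rewrite !ffunE; case: (j == i); rewrite /= inHm_add0.
Qed.

Lemma valid_point_shift c w : valid p (w + point_shift c) = valid p w.
Proof.
rewrite /valid /= !inHm_add0; congr [&& _, _ & _]; apply: eq_forallb => j.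
by rewrite !ffunE /= inHm_add0.
Qed.

Lemma valid_dir_shift N w : valid p (w + dir_shift N) = valid p w.
Proof.
rewrite /valid /= inHm_add0 inHm_phi_add; congr [&& _, _ & _]; apply: eq_forallb => j.
by rewrite !ffunE /= inHm_phi_add.
Qed.

Lemma dir_matrix_shift N w : dir_matrix (w + dir_shift N) = dir_matrix w + map_mx phi N.
Proof.
apply/row_matrixP => i; rewrite linearD /= !rowK second_dirD -map_row; congr (_ + _).
have -> : row i N = prime_row N i by rewrite /prime_row valK.
case: i => -[|i] im //=; rewrite (stepn_ord _ (Ordinal (ltnW im))) ffunE //=.
Qed.

(** Lets invertibility over [F] be decided over ['F_p]. *)
Lemma dir_matrix_valid w : valid p w -> exists N : 'M['F_p]_m, dir_matrix w = map_mx phi N.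
Proof.
case/and3P=> _ h0 /forallP hs.
have hd (i : 'I_m) : inHm p (second_dir w i).
  case: i => -[|i] im //=; rewrite (stepn_ord _ (Ordinal (ltnW im))); exact: hs.
have {}hd i j : exists a, dir_matrix w i j == phi a.
  by have /forallP/(_ j)/HsetP[a e] := hd i; exists a; rewrite mxE e.
exists (\matrix_(i, j) xchoose (hd i j)).
apply/matrixP => i j; rewrite [RHS]mxE [X in phi X]mxE.
exact: (eqP (xchooseP (hd i j))).
Qed.
End PrimeField.
End Walk.

(** * Decoding along the walk *)

Section Distance.
Variables (R : realFieldType) (F : finFieldType) (d : nat).
Local Notation q := (#|F|%:R : R).

(** The seed of the minimum is the distance to 0, itself a codeword, so the minimum is attained on
    the code. *)
Lemma distRM_lt k (A : {set 'rV[F]_k}) (u : table F k) (rho : R) :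
  distRM R d A u < rho -> exists2 c, c \in RM F k d & distA R A u c < rho.
Proof.
rewrite /distRM; elim/big_rec: _ => [h|c r cRM IH]; first by exists 0 => //; exact: RM0.
by rewrite gt_min => /orP[h|/IH//]; exists c.
Qed.

Lemma card_axis (P : pred 'rV[F]_2) :
  #|[set v in L2 F | P v]| = #|[set l : F | P (vec2 l 0)]|.
Proof.
have inj : injective (fun l : F => vec2 l 0).
  by move=> l l' /rowP/(_ ord0); rewrite !mxE.
rewrite -(card_imset _ inj); apply: eq_card => v; rewrite !inE.
apply/andP/imsetP => [[/eqP v1 Pv]|[l]].
  by exists (v ord0 ord0); rewrite ?inE -v1 vec2K.
by rewrite inE => Pl ->; rewrite mxE.
Qed.

Lemma card_L2 : #|L2 F| = #|F|.
Proof.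
have := card_axis predT; rewrite (_ : [set v in _ | _] = L2 F); last first.
  by apply/setP => v; rewrite !inE andbT.
by move=> ->; rewrite -cardsT; apply: eq_card => l; rewrite !inE.
Qed.

Variable rho : R.
Hypotheses (q_gt0 : 0 < q) (dq : (d <= #|F|)%N) (hrho : rho <= (1 - d%:R / q) / 8).

Let rho_q : 8 * (rho * q) <= (#|F| - d)%N%:R.
Proof.
rewrite natrB // -(ler_pM2r (x := 8^-1)) ?invr_gt0 //.
have -> : (q - d%:R) / 8 = (1 - d%:R / q) / 8 * q by field; rewrite lt0r_neq0.
have -> : 8 * (rho * q) / 8 = rho * q by field.
by rewrite ler_pM2r.
Qed.

Lemma distA_near (A : {set 'rV[F]_2}) (g c : table F 2) :
  c \in RM F 2 d -> distA R A g c < rho -> near_codeword d g c.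
Proof.
move=> cRM; rewrite /near_codeword cRM /distA card_mx mul1n natrX /=.
set a := _ / _; set b := #|_| => h.
have a0 : 0 <= a by rewrite divr_ge0 ?mulr_ge0.
rewrite -(ler_nat R) !natrM.
have : b%:R / (2 * q ^+ 2) < rho by lra.
rewrite ltr_pdivrMr ?mulr_gt0 ?exprn_gt0 // => hb.
have : 8 * (rho * q) * q <= (#|F| - d)%N%:R * q by rewrite ler_pM2r.
lra.
Qed.

(** A disagreement at the origin alone contributes 1/2, which exceeds delta/8. *)
Lemma distA_origin (g c : table F 2) : distA R (origin2 F) g c < rho -> g 0 = c 0.
Proof.
move=> h; apply/eqP/contraT => neq; move: h; rewrite /distA /origin2 cards1.
have -> : [set x in [set (0 : 'rV[F]_2)] | g x != c x] = [set 0].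
  by apply/setP => v; rewrite !inE; case: eqP => [->|].
rewrite cards1; set a := _ / _; set b := _ / _ => h.
have b0 : 0 <= b by rewrite divr_ge0 ?mulr_ge0.
have aE : a = 1 / 2 by rewrite /a; field.
have : d%:R / q >= 0 by rewrite divr_ge0 // ltW.
move: hrho h; rewrite aE; set e := d%:R / q => h1 h2 e0; lra.
Qed.

Lemma distA_axis (g c : table F 2) : distA R (L2 F) g c < rho ->
  #|[set l : F | g (vec2 l 0) != c (vec2 l 0)]|%:R < 2 * rho * q.
Proof.
rewrite /distA card_L2 card_axis; set a := #|_|%:R; set b := _ / (_ * #|'rV__|%:R).
have b0 : 0 <= b by rewrite divr_ge0 ?mulr_ge0.
move=> h; have : a / (2 * q) < rho by lra.
by rewrite ltr_pdivrMr ?mulr_gt0 // => ?; lra.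
Qed.

Lemma axis_line (l : F) : vec2 l 0 = 0 + l *: vec2 1 0.
Proof.
by rewrite add0r; apply/rowP => j; rewrite !mxE; case: eqP; rewrite ?mulr1 ?mulr0.
Qed.

Section Walk.
Variables (m : nat) (f Q : table F m) (x : 'rV[F]_m) (w : outcome F m).
Hypotheses (QRM : Q \in RM F m d) (fQx : f x != Q x).

Definition misled (i : nat) : bool :=
  bad_line d (plane f x w i) (plane Q x w i) (line_base w i) (line_dir w i).

Definition disagreements : nat :=
  #|[set l : F | f ((walk x w m).1.1 + l *: (walk x w m).1.2)
              != Q ((walk x w m).1.1 + l *: (walk x w m).1.2)]|.

(** On the common line, f differs from [c] on at most 3(q-d)/4 parameters and from [c'] on fewer
    than (q-d)/4. Hence [c] and [c'] agree on more than [d] parameters, so everywhere there, while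
    [c] differs from [Q] at some point. *)
Lemma codeword_transfer (i : nat) (c c' : table F 2) :
  near_codeword d (plane f x w i) c -> c != plane Q x w i -> ~~ misled i ->
  c' \in RM F 2 d -> distA R (L2 F) (plane f x w i.+1) c' < rho ->
  exists l, c' (vec2 l 0) != plane Q x w i.+1 (vec2 l 0).
Proof.
move=> nc neq good c'RM /distA_axis hc'.
move: good; rewrite negb_exists => /forallP/(_ c); rewrite nc neq /= negb_or -leqNgt.
case/andP; rewrite negb_forall => /existsP[l hl] far.
exists l; rewrite plane_step.
suff -> : c' (vec2 l 0) = c (line_base w i + l *: line_dir w i) by [].
have cRM := proj1 (andP nc).
rewrite axis_line; apply: (RM_line_agree c'RM cRM).
set A := [set _ | _]; set B := [set l : F | _] in hc'; set C := [set l : F | _] in far.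
have : (#|F| <= #|A| + #|B| + #|C|)%N.
  have hAB := leq_of_leqif (leq_card_setU A B).
  have hABC := leq_of_leqif (leq_card_setU (A :|: B) C).
  rewrite -cardsT.
  apply: leq_trans (subset_leq_card _) (leq_trans hABC _); last by rewrite leq_add2r.
  apply/subsetP => y _; rewrite !inE -axis_line plane_step.
  have [->|_] := eqVneq (plane f x w i _) (c' (vec2 y 0)); last by rewrite orbT.
  by rewrite orbF orbN.
have arith (a b e n k : nat) : (n <= a + b + e -> 4 * e <= 3 * (n - k) ->
  4 * b < n - k -> k < a)%N by lia.
move=> covers; apply: (arith _ _ _ _ _ covers far).
rewrite -(ltr_nat R) natrM; move: rho_q hc'; set y := rho * q.
have -> : 2 * rho * q = 2 * y by rewrite /y mulrA.
by move=> h1 h2; lra.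
Qed.

(** On the last line [c] meets [Q] on at most [d] parameters and misses f on fewer than
    [2 * rho * q]; f and [Q] differ on all others. *)
Lemma disagreements_ge (c : table F 2) (l0 : F) : c \in RM F 2 d ->
  c (vec2 l0 0) != plane Q x w m (vec2 l0 0) ->
  distA R (L2 F) (plane f x w m) c < rho ->
  (1 - d%:R / q - 2 * rho) * q <= disagreements%:R.
Proof.
move=> cRM hl0 /distA_axis; set B := [set l : F | _] => hB.
set A := [set l : F | c (vec2 l 0) == plane Q x w m (vec2 l 0)].
have : #|A|%:R <= d%:R :> R.
  rewrite ler_nat leqNgt; apply/negP => hA; case/eqP: hl0.
  rewrite axis_line; apply: (RM_line_agree cRM (plane_RM x w m QRM)).
  by apply: leq_trans hA _; apply: subset_leq_card; apply/subsetP => l; rewrite !inE axis_line.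
have : (#|F| <= #|A| + #|B| + disagreements)%N.
  have hAB := leq_of_leqif (leq_card_setU A B).
  rewrite /disagreements; set D := [set l : F | _ != _].
  have hABD := leq_of_leqif (leq_card_setU (A :|: B) D).
  rewrite -cardsT.
  apply: leq_trans (subset_leq_card _) (leq_trans hABD _); last by rewrite leq_add2r.
  apply/subsetP => y _; rewrite !inE -!plane_axis.
  have [->|_] := eqVneq (plane f x w m _) (c (vec2 y 0)); last by rewrite orbT.
  by rewrite orbF orbN.
rewrite -(ler_nat R) !natrD.
have -> : (1 - d%:R / q - 2 * rho) * q = q - d%:R - 2 * rho * q by field; rewrite lt0r_neq0.
lra.
Qed.

(** The deterministic core: acceptance without a misleading line leaves f far from [Q] on the last
    line. *)
Lemma rejection_cases : (0 < m)%N ->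
  [|| rho <= distRM R d (origin2 F) (plane f x w 0),
      [exists i : 'I_m, rho <= distRM R d (L2 F) (plane f x w i.+1)],
      [exists i : 'I_m, misled i] |
      (1 - d%:R / q - 2 * rho) * q <= disagreements%:R].
Proof.
move=> m0; case: lerP => //= /distRM_lt[c0 c0RM hc0].
case: existsP => //= hL; case: existsP => //= hbad.
have {}hL i : (i < m)%N ->
    exists2 c, c \in RM F 2 d & distA R (L2 F) (plane f x w i.+1) c < rho.
  move=> im; apply: distRM_lt; rewrite ltNge; apply/negP => h.
  by apply: hL; exists (Ordinal im).
have {}hbad i : (i < m)%N -> ~~ misled i.
  by move=> im; apply/negP => h; apply: hbad; exists (Ordinal im).
have H i : (i < m)%N ->
    exists c, near_codeword d (plane f x w i) c /\ c != plane Q x w i.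
  elim: i => [_|i IH im].
    exists c0; split; first exact: distA_near hc0.
    apply: contraNneq fQx => e.
    by rewrite -(plane_origin f x w) (distA_origin hc0) e plane_origin.
  have [c [nc neq]] := IH (ltnW im).
  have [c' c'RM hc'] := hL _ (ltnW im).
  exists c'; split; first exact: distA_near hc'.
  have [l hl] := codeword_transfer nc neq (hbad _ (ltnW im)) c'RM hc'.
  by apply: contraNneq hl => ->.
(* The last transfer stays outside the induction, as it must yield a point of the axis of P_m where
   the codeword differs from [Q]. *)
have [n mE] : exists n, m = n.+1 by exists m.-1; rewrite prednK.
have nm : (n < m)%N by rewrite mE.
have [c [nc neq]] := H _ nm.
have [c' c'RM hc'] := hL _ nm.
have [l] := codeword_transfer nc neq (hbad _ nm) c'RM hc'.
rewrite -mE => hl; rewrite -mE in hc'; exact: disagreements_ge hl hc'.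
Qed.
End Walk.
End Distance.

(** * Probability estimates *)

(** A reverse Bernoulli inequality; each induction step gains from [y * (1 - m%:R * y) >= 0].
    Applied with y = 4/q, it yields 1 - 2m/q. *)
Lemma Bernoulli_half (R : realFieldType) (y : R) (m : nat) :
  0 <= y -> y <= 1 -> m%:R * y <= 1 -> (1 - y) ^+ m <= 1 - m%:R * y / 2.
Proof.
move=> y0 y1; elim: m => [|m IH] my; first by rewrite expr0 mul0r mul0r subr0.
have m0 : 0 <= m%:R :> R by exact: ler0n.
move: my; rewrite -natr1 => my.
have {}IH : (1 - y) ^+ m <= 1 - m%:R * y / 2 by apply: IH; lra.
have y10 : 0 <= 1 - y by rewrite subr_ge0.
rewrite exprS; apply: le_trans (ler_wpM2l y10 IH) _.
have h : 0 <= y * (1 - m%:R * y) by rewrite mulr_ge0 // subr_ge0; lra.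
nra.
Qed.

Section Probability.
Variables (R : realFieldType) (F : finFieldType) (p d m : nat).
Local Notation q := (#|F|%:R : R).
Variables (f Q : table F m) (x : 'rV[F]_m).
Local Notation V := [set w : outcome F m | valid p w].

(** Under [line_shift] the plane P_i is constant while the pair of base and direction runs over all
    pairs, so [bad_line_count] applies on each orbit. *)
Lemma misled_count (i : 'I_m) : (8 <= #|F|)%N -> (4 * d <= #|F|)%N -> Q \in RM F m d ->
  (\sum_(w in V) (misled d f Q x w i)%:R) * q <= 2 * #|V|%:R.
Proof.
move=> q8 d4 QRM.
have q0 : 0 < q by rewrite ltr0n; lia.
have q4 : 0 < q ^+ 3 by rewrite exprn_gt0.
have inj t : injective (fun w : outcome F m => w + line_shift i t : outcome F m) by apply: addIr.
have inv t (w : outcome F m) : (w + line_shift i t \in V) = (w \in V).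
  by rewrite !inE valid_line_shift.
have := @sum_shift_le R (outcome F m) ('rV[F]_2 * 'rV[F]_2)%type
  (fun t w => w + line_shift i t) V inj inv
  (fun w => (misled d f Q x w i)%:R) (2 * q ^+ 3).
rewrite card_prod card_mx mul1n natrM natrX; set S := \sum_(w in V) _ => H.
rewrite -(ler_pM2r q4).
have -> : S * q * q ^+ 3 = q ^+ 2 * q ^+ 2 * S by ring.
have -> : 2 * #|V|%:R * q ^+ 3 = #|V|%:R * (2 * q ^+ 3) by ring.
apply: H => w _.
apply: (le_trans _ (bad_line_count R q8 d4 (plane f x w i) (plane_RM x w i QRM))).
rewrite pair_big [leRHS](reindex_inj (h := fun t => (line_base w i + t.1, line_dir w i + t.2))) /=.
  by apply: ler_sum => t _; rewrite /misled !plane_line_shift line_base_shift line_dir_shift lexx.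
by move=> [a b] [a' b'] /= [/addrI-> /addrI->].
Qed.

(** Shifting by [N] turns the matrix image of [N0] into that of [N0 + N], which runs over all
    matrices over ['F_p]. *)
Lemma singular_count (phi : {rmorphism 'F_p -> F}) :
  (forall a, phi a = (a : nat)%:R) -> prime p -> (0 < m)%N ->
  #|[set w in V | dir_matrix w \notin unitmx]|%:R <= 2 / p%:R * #|V|%:R :> R.
Proof.
move=> phiE pr m0.
have inj N : injective (fun w : outcome F m => w + dir_shift phi N : outcome F m) by apply: addIr.
have inv N (w : outcome F m) : (w + dir_shift phi N \in V) = (w \in V).
  by rewrite !inE valid_dir_shift.
have n0 : 0 < #|'M['F_p]_m|%:R :> R by rewrite ltr0n card_mx expn_gt0 card_Fp // prime_gt0.
have := @sum_shift_le R (outcome F m) 'M['F_p]_m (fun N w => w + dir_shift phi N) V inj inv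
  (fun w => (dir_matrix w \notin unitmx)%:R) (2 / p%:R * #|'M['F_p]_m|%:R).
rewrite -natr_card_set => H; rewrite -(ler_pM2l n0).
have -> : #|'M['F_p]_m|%:R * (2 / p%:R * #|V|%:R) = #|V|%:R * (2 / p%:R * #|'M['F_p]_m|%:R) :> R.
  by ring.
apply: H.
move=> w; rewrite inE => /(dir_matrix_valid pr phiE)[N0 e].
apply: (le_trans _ (card_singular R pr m0)).
rewrite natr_card_pred [leRHS](reindex_inj (addrI N0)) /=.
apply: ler_sum => N _.
by rewrite dir_matrix_shift e -map_mxD map_unitmx lexx.
Qed.

(** Singular outcomes are charged the trivial bound [q]; on the others x_m is uniform, so each of
    the [q] points of the last line lies in the disagreement set with probability [hdist R f Q]. *)
Lemma disagreements_mean (phi : {rmorphism 'F_p -> F}) :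
  (forall a, phi a = (a : nat)%:R) -> prime p -> (0 < m)%N ->
  \sum_(w in V) (disagreements f Q x w)%:R <= q * (hdist R f Q + 2 / p%:R) * #|V|%:R.
Proof.
move=> phiE pr m0.
rewrite (bigID (fun w => dir_matrix w \in unitmx)) /=.
have hsing : \sum_(w in V | dir_matrix w \notin unitmx) (disagreements f Q x w)%:R
    <= q * (2 / p%:R * #|V|%:R).
  rewrite big_mkcondr /=.
  apply: le_trans (_ : \sum_(w in V) q * (dir_matrix w \notin unitmx)%:R <= _).
    apply: ler_sum => w _; case: ifP => _; last by rewrite mulr0.
    by rewrite mulr1 ler_nat max_card.
  by rewrite -mulr_sumr -natr_card_set ler_wpM2l // (singular_count phiE).
have hreg : \sum_(w in V | dir_matrix w \in unitmx) (disagreements f Q x w)%:R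
    <= q * hdist R f Q * #|V|%:R.
  pose V2 := [set w in V | dir_matrix w \in unitmx].
  rewrite (eq_bigl (fun w => w \in V2)) => [|w]; last by rewrite !inE.
  have inj c : injective (fun w : outcome F m => w + point_shift c : outcome F m).
    exact: addIr.
  have inv c (w : outcome F m) : (w + point_shift c \in V2) = (w \in V2).
    by rewrite !inE valid_point_shift dir_matrix_point_shift.
  have := @sum_shift_le R (outcome F m) 'rV[F]_m (fun c w => w + point_shift c) V2 inj inv
    (fun w => (disagreements f Q x w)%:R) (q * #|[set y | f y != Q y]|%:R).
  have n0 : 0 < #|'rV[F]_m|%:R :> R.
    by rewrite ltr0n; apply/card_gt0P; exists 0.
  rewrite /hdist; set D : R := #|[set y | _]|%:R => H.
  have D0 : 0 <= D by exact: ler0n.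
  rewrite -(ler_pM2l n0); apply: le_trans (H _) _ => [w|].
    rewrite inE => /andP[_ uM].
    under eq_bigr => c _ do
      rewrite /disagreements walk_point_shift_end /= natr_card_pred.
    rewrite exchange_big /= -sum_const_natr; apply: ler_sum => l _.
    rewrite /D natr_card_pred.
    (* For fixed [l] the point is a bijective function of [c], since the matrix is invertible and
       the last direction does not move. *)
    rewrite [leRHS](reindex_inj
      (h := fun c => (walk x w m).1.1 + c *m dir_matrix w + l *: (walk x w m).1.2)) //=.
    by move=> c c' /addIr/addrI/(can_inj (mulmxK uM)).
  have VV : #|V2|%:R <= #|V|%:R :> R.
    rewrite ler_nat; apply: subset_leq_card; apply/subsetP => w.
    by case/setIdP.
  have -> : #|'rV[F]_m|%:R * (q * (D / #|'rV[F]_m|%:R) * #|V|%:R) = #|V|%:R * (q * D).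
    by field; rewrite lt0r_neq0.
  by rewrite ler_wpM2r // mulr_ge0.
by rewrite mulrDr mulrDl -[q * (2 / _) * _]mulrA; exact: lerD.
Qed.
End Probability.

Theorem mainTheorem4 (R : realFieldType) (F : finFieldType) (p m d : nat) (tau rho : R) :
  (2 <= d)%N -> (2 <= m)%N ->
  prime p -> p \in [pchar F] -> #|F| = (p ^ m)%N ->
  (2 * m * d <= #|F|)%N ->
  let delta : R := 1 - d%:R / #|F|%:R in
  tau <= delta / 2 -> rho <= delta / 8 ->
  (* (1) perfect completeness *)
  (forall (f : table F m) (x : 'rV[F]_m) (w : outcome F m),
      f \in RM F m d -> valid p w ->
      forall i : nat, (i <= m)%N -> plane f x w i \in RM F 2 d)
  /\
  (* (2) robust soundness *)
  (forall (f Q : table F m) (x : 'rV[F]_m),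
      Q \in RM F m d -> hdist R f Q <= tau -> f x != Q x ->
      Prw R p (fun w : outcome F m =>
             (rho <= distRM R d (origin2 F) (plane f x w 0))
          || [exists i : 'I_m, rho <= distRM R d (L2 F) (plane f x w i.+1)])
      >= (1 - 4 / #|F|%:R) ^+ m - (tau + 2 / p%:R) / (delta - 2 * rho)).
Proof.
move=> d2 m2 pr chF _ q_ge delta _ hrho; split=> [f x w fRM _ i _|f Q x QRM hf fQx].
  exact: plane_RM.
have m0 : (0 < m)%N by lia.
(* These bounds come from 2md <= |F| with m, d >= 2. *)
have q8 : (8 <= #|F|)%N by nia.
have d4 : (4 * d <= #|F|)%N by nia.
have m4 : (4 * m <= #|F|)%N by nia.
have dq : (d <= #|F|)%N by lia.
set q : R := #|F|%:R in delta hrho *.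
have q0 : 0 < q by rewrite ltr0n; lia.
have [phi phiE] := prime_subfield_embedding chF.
set V := [set w : outcome F m | valid p w].
have V0 : 0 < #|V|%:R :> R.
  have zero_in : inHm p (0 : 'rV[F]_m).
    by apply/forallP => i; rewrite mxE; apply/(HsetP pr phiE); exists 0; rewrite rmorph0.
  rewrite ltr0n; apply/card_gt0P; exists 0; rewrite inE /valid zero_in /=.
  by apply/forallP => j; rewrite ffunE.
pose E (w : outcome F m) := (rho <= distRM R d (origin2 F) (plane f x w 0))
  || [exists i : 'I_m, rho <= distRM R d (L2 F) (plane f x w i.+1)].
have dq1 : d%:R / q <= 1 / 4.
  by rewrite ler_pdivrMr // -(ler_pM2l (x := 4)) //; move: d4; rewrite -(ler_nat R) natrM; lra.
set gap := delta - 2 * rho.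
(* Here delta >= 3/4 and 2 rho <= delta/4. *)
have gap0 : 0 < gap.
  by move: dq1 hrho; rewrite /gap /delta; set y := d%:R / q; lra.
pose far w := gap * q <= (disagreements f Q x w)%:R.
(* Union bound over the alternatives of [rejection_cases]. *)
have cover : #|V|%:R <= #|[set w in V | E w]|%:R
   + \sum_(i < m) (\sum_(w in V) (misled d f Q x w i)%:R) + #|[set w in V | far w]|%:R :> R.
  rewrite exchange_big /= !natr_card_set -!big_split /=.
  rewrite -sum1_card natr_sum; apply: ler_sum => w _.
  have := rejection_cases q0 dq hrho w QRM fQx m0.
  rewrite orbA -/(E w) -/gap -/q -/(far w).
  have s0 : 0 <= \sum_(i < m) (misled d f Q x w i)%:R :> R by apply: sumr_ge0.
  case/or3P=> [->|/existsP[i hi]|->].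
  - by rewrite -addrA lerDl addr_ge0.
  - rewrite (bigD1 i) //= hi addrAC addrCA lerDl !addr_ge0 //.
    by apply: sumr_ge0.
  - by rewrite lerDr addr_ge0.
have hmis : (\sum_(i < m) (\sum_(w in V) (misled d f Q x w i)%:R)) * q <= m%:R * (2 * #|V|%:R).
  rewrite mulr_suml -[m in m%:R]card_ord -sum_const_natr; apply: ler_sum => i _.
  exact: misled_count.
(* Markov's inequality: each far outcome contributes at least [gap * q] disagreements. *)
have hfar : #|[set w in V | far w]|%:R * gap <= (tau + 2 / p%:R) * #|V|%:R.
  rewrite -(ler_pM2r q0) -mulrA natr_card_set mulr_suml.
  apply: le_trans (_ : \sum_(w in V) (disagreements f Q x w)%:R <= _).
    apply: ler_sum => w _; rewrite /far; case: (lerP (gap * q)) => h; first by rewrite mul1r.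
    by rewrite mul0r.
  apply: le_trans (disagreements_mean R f Q x phiE pr m0) _.
  rewrite -/q -/V [leRHS]mulrC mulrA ler_pM2r // ler_pM2l //.
  by rewrite lerD2r.
rewrite /Prw -/V.
have -> : [set w | valid p w && ((rho <= distRM R d (origin2 F) (plane f x w 0))
          || [exists i : 'I_m, rho <= distRM R d (L2 F) (plane f x w i.+1)])] = [set w in V | E w].
  by apply/setP => w; rewrite !inE.
rewrite ler_pdivlMr //.
have hB : (1 - 4 / q) ^+ m <= 1 - m%:R * (4 / q) / 2.
  apply: Bernoulli_half; first by rewrite divr_ge0 // ltW.
    by rewrite ler_pdivrMr // mul1r ler_nat; lia.
  by rewrite mulrA ler_pdivrMr // mul1r mulrC -natrM ler_nat.
set S := \sum_i _ in cover hmis.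
have hS : S <= m%:R * 2 / q * #|V|%:R.
  by rewrite mulrAC ler_pdivlMr // (le_trans hmis) // mulrA.
have hW : #|[set w in V | far w]|%:R <= (tau + 2 / p%:R) / gap * #|V|%:R.
  by rewrite mulrAC ler_pdivlMr.
set X := (tau + _) / gap in hW *.
have hB' : (1 - 4 / q) ^+ m <= 1 - m%:R * 2 / q.
  by apply: le_trans hB _; rewrite le_eqVlt; apply/orP; left; apply/eqP; field; rewrite lt0r_neq0.
have : ((1 - 4 / q) ^+ m - X) * #|V|%:R <= (1 - m%:R * 2 / q - X) * #|V|%:R.
  by rewrite ler_pM2r // lerD2r.
move: hS; set Y := m%:R * 2 / q; lra.
Qed.
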